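(* For any finite multiset $B$ of integers with $|B|<0$ and any sequence of permutations $\phi=(\phi_1,\phi_2,\dots)$ with $\phi_i\in\mathfrak S_i$, the Order sweep map is a bijection from $\mathcal D^o_B$ to $\mathcal D^o_B$.
   Context: An incomplete Dyck path of type $B$ is a sequence $(b_1,\dots,b_N)$ with multiset of entries $B$ such that $a:=-(b_1+\cdots+b_N)>0$ and $a+b_1+\cdots+b_i\ge0$ for all $i$. Its $i$-th arrow is the vector $(1,b_i)$ with starting rank $r_i=a+b_1+\cdots+b_{i-1}$. $\mathcal D^o_B$ is the set of incomplete Dyck paths of type $B$. Order sweep map: let $i_1<\dots<i_k$ be the indices with $r_i=0$. $\mathrm{Osweep}$ lists the steps $b_i$ ordered by starting rank $0,1,2,\dots$; among arrows of equal starting rank $r\neq0$ from right to left (decreasing $i$); the arrows of starting rank $0$ in the order $b_{i_{\phi_k(1)}},\dots,b_{i_{\phi_k(k)}}$. *)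

(* Defs.v *)
From mathcomp Require Import all_boot all_order all_algebra all_fingroup.
From mathcomp Require Import finmap multiset.
From mathcomp Require Import boolp classical_sets functions.

Set Implicit Arguments.
Unset Strict Implicit.
Unset Printing Implicit Defensive.

Import Order.TTheory GRing.Theory Num.Theory.

Local Open Scope mset_scope.
Local Open Scope classical_set_scope.
Local Open Scope ring_scope.

Definition init_rank (b : seq int) : int := - \sum_(x <- b) x.

(* Rank reached after i steps.  Arrows are numbered from 0, so this is the
   starting rank of arrow i when (i < size b)%N, i.e. r_(i+1) with the usual
   numbering from 1, and the final rank 0 when i = size b. *)
Definition rank (b : seq int) (i : nat) : int :=
  init_rank b + \sum_(x <- take i b) x.

Definition incomplete_dyck (B : {mset int}) : set (seq int) :=
  [set b | [/\ seq_mset b = B,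
               0 < init_rank b
             & forall i, (i <= size b)%N -> 0 <= rank b i]].

(* Increasing list of the (0-based) arrows starting at rank r. *)
Definition arrows_at (b : seq int) (r : nat) : seq nat :=
  [seq i <- iota 0 (size b) | rank b i == r%:Z].

Definition zero_arrows (phi : forall k : nat, 'S_k) (b : seq int) : seq nat :=
  let s := arrows_at b 0 in
  [seq nth 0%N s (phi (size s) j) | j <- enum 'I_(size s)].

Definition level_arrows (phi : forall k : nat, 'S_k) (b : seq int) (r : nat) :
    seq nat :=
  if r is 0 then zero_arrows phi b else rev (arrows_at b r).

(* Starting ranks of an incomplete Dyck path are nonnegative, so the absolute
   value only serves to land in nat. *)
Definition max_rank (b : seq int) : nat := \max_(i < size b) `|rank b i|%N.

Definition Osweep (phi : forall k : nat, 'S_k) (b : seq int) : seq int :=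
  [seq nth 0 b i |
    i <- flatten [seq level_arrows phi b r | r <- iota 0 (max_rank b).+1]].

(* Main.v *)
Require Import Defs.
From mathcomp Require Import all_boot all_order all_algebra all_fingroup.
From mathcomp Require Import finmap multiset.
From mathcomp Require Import boolp classical_sets functions.
From mathcomp Require Import zify ring.

Import Order.TTheory GRing.Theory Num.Theory.

Local Open Scope mset_scope.
Local Open Scope classical_set_scope.
Local Open Scope ring_scope.

(** A path b is an Eulerian trail from a to 0 on the levels.  Write w for the
    swept word and r for the starting ranks of the arrows in sweep order; r is
    nondecreasing and determines b from w.  The pair (w, r) is balanced: the
    multisets {0} + {r_i} and {a} + {r_i + w_i} coincide.  Moreover the first
    swept arrow of a level l > 0 is the last exit of b from l, so following
    these first arrows visits levels with ever later last exit times.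

    Injectivity: given w, the pointwise minimum of two balanced nondecreasing
    rank sequences is again balanced, and a balanced s <= r with s <> r would
    force a cycle among the first arrows of r; hence r is unique.  This never
    looks at the order of the arrows leaving level 0, so phi is arbitrary.
    Bijectivity follows because there are finitely many words of type B. *)

(** * Balanced rank sequences *)

(** Multisets are encoded by cumulative counts: equal multisets have equal counts at every [l], and
    a pointwise comparison of sequences becomes an inequality of counts. *)
Definition below (n : nat) (f : nat -> int) (l : int) : nat :=
  (\sum_(i < n) (f i < l)%R)%N.

(** The terms [0 < l] and [a < l] add the final rank 0 to the starts and the initial rank [a] to the
    ends, so that both sides count all ranks visited by a path. *)
Definition balanced (n : nat) (a : int) (w r : nat -> int) : Prop :=
  [/\ forall i, (i < n)%N -> 0 <= r i,
      forall i, (i < n)%N -> 0 <= r i + w i &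
      forall l, (below n r l + (0 < l)%R =
                 below n (fun i => r i + w i)%R l + (a < l)%R)%N].

Definition nondecreasing_upto (n : nat) (r : nat -> int) : Prop :=
  forall i j, (i <= j < n)%N -> r i <= r j.

Definition first_at (r : nat -> int) (k : nat) : Prop :=
  forall j, (j < k)%N -> r j < r k.

(* In the intended use t k is the time at which the path traverses the k-th
   swept arrow. *)
Definition exits_increase (n : nat) (w r : nat -> int) (t : nat -> nat) : Prop :=
  forall k k', (k < n)%N -> (k' < n)%N -> first_at r k -> first_at r k' ->
    0 < r k -> 0 < r k' -> r k' = r k + w k -> (t k < t k')%N.

Lemma leq_below n f g l :
  (forall i, (i < n)%N -> f i <= g i) -> (below n g l <= below n f l)%N.
Proof.
move=> fg; apply: leq_sum => i _; have := fg _ (ltn_ord i).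
by case: (ltP (f i) l); case: (ltP (g i) l) => //; lia.
Qed.

Lemma ltn_below n f g l k :
  (forall i, (i < n)%N -> f i <= g i) -> (k < n)%N -> f k < l <= g k ->
  (below n g l < below n f l)%N.
Proof.
move=> fg kn /andP[fl gl]; rewrite /below.
rewrite (bigD1 (Ordinal kn)) //= [ltnRHS](bigD1 (Ordinal kn)) //= fl ltNge gl /=.
rewrite add0n add1n ltnS; apply: leq_sum => i _; have := fg _ (ltn_ord i).
by case: (ltP (f i) l); case: (ltP (g i) l) => //; lia.
Qed.

Lemma below_ltn_ex n f g l :
  (below n g l < below n f l)%N -> exists2 i, (i < n)%N & f i < l <= g i.
Proof.
move=> h; case: (boolP [exists i : 'I_n, f i < l <= g i]) => [/existsP[i hi]|].
  by exists i.
rewrite negb_exists => /forallP hn; suff: (below n f l <= below n g l)%N by lia.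
apply: leq_sum => i _; have := hn i.
by case: (ltP (f i) l); case: (ltP (g i) l) => //; lia.
Qed.

Lemma ex_first_at n r i : nondecreasing_upto n r -> (i < n)%N ->
  exists k, [/\ (k <= i)%N, r k = r i & first_at r k].
Proof.
move=> mr ni; have ex : exists k, r k == r i by exists i.
case: (ex_minnP ex) => k /eqP ek mink; have ki := mink _ (eqxx _).
exists k; split=> // j jk; rewrite lt_neqAle; apply/andP; split.
  by apply/eqP => e; have := mink j; rewrite e ek eqxx => /(_ isT); lia.
by apply: mr; lia.
Qed.

(** A positive level that is entered is also left. Between [m] and [m + 1] the term [0 < l] stays 1
    while the count of ends jumps, so some start equals [m]. *)
Lemma balanced_occupied n a w r i : balanced n a w r -> (i < n)%N ->
  0 < r i + w i -> exists2 j, (j < n)%N & r j = r i + w i.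
Proof.
set m := r i + w i => -[_ _ bal] ni m0.
have h1 := bal m; have h2 := bal (m + 1).
have le1 : ((a < m)%R <= (a < m + 1)%R)%N by lia.
have lt1 : (below n (fun i => r i + w i)%R m <
              below n (fun i => r i + w i)%R (m + 1)%R)%N.
  rewrite /below (bigD1 (Ordinal ni)) //= [ltnRHS](bigD1 (Ordinal ni)) //= -/m ltxx.
  by rewrite ltrDl /= add0n add1n ltnS; apply: leq_sum => j _; lia.
have {h1 h2 le1 lt1} h : (below n r m < below n r (m + 1)%R)%N by lia.
(* Over the integers [r i < m + 1] means [r i - 1 < m], so the witness satisfies
   [r j - 1 < m <= r j]. *)
have := @below_ltn_ex n (fun i => r i - 1) r m.
case.
  rewrite [X in (_ < X)%N](_ : _ = below n r (m + 1)) //.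
  by apply: eq_bigr => j _; congr nat_of_bool; lia.
by move=> j jn hj; exists j => //; lia.
Qed.

(* If s k < r k at the first arrow k of a level of r, comparing the two balance
   equations at the end of that arrow yields the same inequality at the first
   arrow of the level reached; exit times forbid repeating this forever. *)
Lemma balanced_ge_eq n a w r s t N :
  balanced n a w r -> balanced n a w s ->
  nondecreasing_upto n r -> nondecreasing_upto n s ->
  exits_increase n w r t -> (forall k, (k < n)%N -> (t k < N)%N) ->
  (forall i, (i < n)%N -> s i <= r i) -> forall i, (i < n)%N -> s i = r i.
Proof.
move=> br bs mr ms ext tN sr.
have no_first d : forall k, (k < n)%N -> first_at r k -> s k < r k ->
    (N - t k <= d)%N -> False.
  elim: d => [|d IH] k kn fk srk td; first by have := tN _ kn; lia.
  case: (br) (bs) => r0 rw0 balr [s0 _ bals].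
  have sk0 := s0 _ kn; set m := r k + w k.
  have bm : (below n r m < below n s m)%N.
    suff : (below n (fun i => r i + w i)%R m < below n (fun i => s i + w i)%R m)%N.
      by have := balr m; have := bals m; lia.
    apply: (@ltn_below _ _ _ _ k) => //; last by rewrite /m; lia.
    by move=> i ni; have := sr _ ni; lia.
  have [j jn /andP[sj rj]] := @below_ltn_ex _ _ _ _ bm.
  have m0 : 0 < m by have := s0 _ jn; lia.
  have [j2 j2n rj2] := balanced_occupied n a w r k br kn m0.
  have [k' [k'j2 rk' fk']] := ex_first_at n r j2 mr j2n.
  have k'n : (k' < n)%N by lia.
  have rk'm : r k' = m by rewrite rk'.
  apply: (IH k' k'n fk').
    (* Since [m <= r j], the first arrow [k'] of level [m] comes no later than [j]; monotonicity of
       [s] then carries [s j < m] back to [k']. *)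
    have k'j : (k' <= j)%N.
      by rewrite leqNgt; apply/negP => /fk'; lia.
    by have := ms k' j; rewrite k'j jn => /(_ isT); lia.
  by have := ext k k' kn k'n fk fk'; have := tN _ kn; rewrite rk'm; lia.
move=> i ni; apply/eqP; rewrite eq_le sr //= leNgt; apply/negP => lt.
have [k [ki rk fk]] := ex_first_at n r i mr ni.
apply: (no_first (N - t k)%N k) => //; first by lia.
by have := ms k i; rewrite ki ni => /(_ isT); lia.
Qed.

(** * Minima of balanced sequences *)

Lemma sum_lt_nat (x : int) (M : nat) : 0 <= x -> x < M%:Z ->
  ((\sum_(l < M) (x < l%:Z)%R)%N)%:Z = M%:Z - 1 - x.
Proof.
move=> x0 xM; suff h : forall K, (\sum_(l < K) (x < l%:Z)%R)%N = (K - `|x|.+1)%N.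
  by rewrite h; lia.
elim=> [|K IH]; first by rewrite big_ord0.
by rewrite big_ord_recr /= IH; case: ltP; lia.
Qed.

(** Summed over the levels, the counts depend on [f] only through its sum, which makes total balance
    a linear identity. *)
Lemma sum_below n f (M : nat) : (forall i, (i < n)%N -> 0 <= f i < M%:Z) ->
  ((\sum_(l < M) below n f l%:Z)%N)%:Z = \sum_(i < n) (M%:Z - 1 - f i).
Proof.
move=> hf; rewrite /below exchange_big /= -natz natr_sum.
apply: eq_bigr => i _; have /andP[f0 fM] := hf _ (ltn_ord i).
by rewrite natz sum_lt_nat.
Qed.

(** By monotonicity the indices with value below [l] form an initial segment for [r] and for [s].
    The two segments are nested, and their union is one of them. *)
Lemma below_min n (r s : nat -> int) (l : int) :
  nondecreasing_upto n r -> nondecreasing_upto n s ->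
  let q i := Num.min (r i) (s i) in
  below n q l = below n r l \/ below n q l = below n s l.
Proof.
move=> mr ms q.
case: (boolP [forall i : 'I_n, (s i < l) ==> (r i < l)]) => [/forallP sr|].
  left; apply: eq_bigr => i _; congr nat_of_bool.
  by have := sr i; rewrite /q gt_min; case: (r i < l); case: (s i < l).
rewrite negb_forall => /existsP[i]; rewrite negb_imply => /andP[si ri]; right.
apply: eq_bigr => j _; congr nat_of_bool; rewrite /q gt_min.
case: (ltP (s j) l) => sj; rewrite ?orbT // orbF; apply/negbTE.
have ni := ltn_ord i; have nj := ltn_ord j.
have [ij|ji] := leqP i j; first by have := mr i j; rewrite ij nj => /(_ isT); lia.
by have := ms j i; rewrite (ltnW ji) ni => /(_ isT); lia.
Qed.

(* The inequality between the two sides of the balance equation is immediate;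
   summed over all levels it becomes an equality because the steps sum to -a. *)
Lemma balanced_min n (a : int) (w r s : nat -> int) : 0 <= a -> \sum_(i < n) w i = - a ->
  balanced n a w r -> balanced n a w s ->
  nondecreasing_upto n r -> nondecreasing_upto n s ->
  balanced n a w (fun i => Num.min (r i) (s i)).
Proof.
move=> a0 sumw [r0 rw0 balr] [s0 sw0 bals] mr ms.
set q := fun i => Num.min (r i) (s i); pose e i := q i + w i.
have q0 i : (i < n)%N -> 0 <= q i.
  by move=> ni; rewrite /q le_min r0 ?s0.
have e0 i : (i < n)%N -> 0 <= e i.
  by move=> ni; rewrite /e /q minEle; case: ifP => _; [exact: rw0 | exact: sw0].
split=> // l; rewrite -/(below n e l).
have le_l k : (below n q k + (0 < k)%R <= below n e k + (a < k)%R)%N.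
  have [->|->] := below_min n r s k mr ms.
    rewrite balr leq_add2r; apply: leq_below => i _.
    by rewrite /e lerD2r ge_min lexx.
  rewrite bals leq_add2r; apply: leq_below => i _.
  by rewrite /e lerD2r ge_min lexx orbT.
have below0 f : (forall i, (i < n)%N -> 0 <= f i) -> l <= 0 -> below n f l = 0%N.
  by move=> f0 l0; apply: big1 => i _; have := f0 _ (ltn_ord i); lia.
have [l0|l0] := leP l 0; first by rewrite !below0 //; lia.
(* [M] exceeds [l], [a] and all starts and ends, so that the sums over levels below [M] can be
   evaluated. *)
pose M := (`|l| + `|a| + \sum_(i < n) (`|q i| + `|e i|)).+1%N.
have qeM i : (i < n)%N -> q i < M%:Z /\ e i < M%:Z.
  move=> ni; have := q0 _ ni; have := e0 _ ni; rewrite /M (bigD1 (Ordinal ni)) //=.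
  by split; lia.
have [_ sum_eq] : (\sum_(k < M) (below n q k%:Z + (0 < k%:Z)%R) <=
    \sum_(k < M) (below n e k%:Z + (a < k%:Z)%R) ?=
    iff [forall k : 'I_M, below n q k%:Z + (0 < k%:Z)%R ==
         below n e k%:Z + (a < k%:Z)%R])%N.
  by apply: leqif_sum => k _; split=> //; exact: le_l.
have lM : (`|l| < M)%N by rewrite /M; lia.
suff : [forall k : 'I_M, (below n q k%:Z + (0 < k%:Z)%R ==
         below n e k%:Z + (a < k%:Z)%R)%N].
  move=> /forallP /(_ (Ordinal lM)) /eqP /=.
  by rewrite gtz0_abs // l0.
have aM : a < M%:Z by rewrite /M; lia.
have M0 : 0 < M%:Z by lia.
(* Equality at every level amounts to equality of the totals, which differ by [a] plus the sum of
   the steps. *)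
rewrite -sum_eq !big_split /= -eqz_nat !PoszD !sum_lt_nat //.
rewrite !sum_below; first last.
- by move=> i ni; rewrite q0 // (qeM _ ni).1.
- by move=> i ni; rewrite e0 // (qeM _ ni).2.
rewrite /e !sumrB big_split /= sumw; apply/eqP; ring.
Qed.

Lemma balanced_unique n (a : int) (w r s : nat -> int) t u N :
  0 <= a -> \sum_(i < n) w i = - a ->
  balanced n a w r -> balanced n a w s ->
  nondecreasing_upto n r -> nondecreasing_upto n s ->
  exits_increase n w r t -> (forall k, (k < n)%N -> (t k < N)%N) ->
  exits_increase n w s u -> (forall k, (k < n)%N -> (u k < N)%N) ->
  forall i, (i < n)%N -> r i = s i.
Proof.
move=> a0 sumw br bs mr ms er tN es uN i ni.
have bq := balanced_min n a w r s a0 sumw br bs mr ms.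
have mq : nondecreasing_upto n (fun i => Num.min (r i) (s i)).
  by move=> j k jk; rewrite le_min !ge_min mr // ms // orbT.
rewrite -(balanced_ge_eq n a w r _ t N br bq mr mq er tN _ i ni).
  apply: (balanced_ge_eq n a w s _ u N bs bq ms mq es uN) => // j _.
  by rewrite ge_min lexx orbT.
by move=> j _; rewrite ge_min lexx.
Qed.

(** * The sweep order *)

Lemma rank0 b : rank b 0 = init_rank b.
Proof. by rewrite /rank take0 big_nil addr0. Qed.

Lemma rank_size b : rank b (size b) = 0.
Proof. by rewrite /rank take_size /init_rank addNr. Qed.

Lemma rankS b i : (i < size b)%N -> rank b i.+1 = rank b i + nth 0 b i.
Proof.
by move=> ib; rewrite /rank (take_nth 0 ib) -cats1 big_cat /= big_seq1 addrA.
Qed.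

Lemma leq_max_rank b i : (i < size b)%N -> (`|rank b i| <= max_rank b)%N.
Proof.
move=> ib; exact: (@leq_bigmax _ (fun j : 'I_(size b) => `|rank b j|%N) (Ordinal ib)).
Qed.

Definition nonneg_ranks (b : seq int) : Prop :=
  forall i, (i <= size b)%N -> 0 <= rank b i.

(** Arrow indices are kept instead of steps, so that each swept letter retains its rank and its time
    on the path. *)
Definition sweep_order (phi : forall k : nat, 'S_k) (b : seq int) : seq nat :=
  flatten [seq level_arrows phi b r | r <- iota 0 (max_rank b).+1].

Lemma OsweepE phi b : Osweep phi b = [seq nth 0 b i | i <- sweep_order phi b].
Proof. by []. Qed.

Lemma perm_map_nth_perm (T : eqType) (x0 : T) (s : seq T) (p : 'S_(size s)) :
  perm_eq [seq nth x0 s (p j) | j <- enum 'I_(size s)] s.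
Proof.
rewrite (map_comp (fun j : 'I_(size s) => nth x0 s j) p).
have -> : perm_eq [seq nth x0 s (nat_of_ord j) | j <- [seq p i | i <- enum 'I_(size s)]] s
  = perm_eq [seq nth x0 s (nat_of_ord j) | j <- [seq p i | i <- enum 'I_(size s)]]
     [seq nth x0 s (nat_of_ord j) | j <- enum 'I_(size s)].
  congr perm_eq; rewrite (map_comp (nth x0 s) (@nat_of_ord _)) val_enum_ord.
  by rewrite map_nth_iota0 ?take_size.
apply: perm_map; apply: uniq_perm; rewrite ?enum_uniq //.
  by rewrite map_inj_uniq ?enum_uniq //; exact: perm_inj.
move=> i; rewrite mem_enum; apply/mapP; exists (p^-1%g i); rewrite ?mem_enum //.
by rewrite permKV.
Qed.

Lemma perm_level_arrows phi b l : perm_eq (level_arrows phi b l) (arrows_at b l).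
Proof.
by case: l => [|l]; rewrite /level_arrows ?perm_rev // perm_map_nth_perm.
Qed.

Lemma mem_arrows_at b l i :
  (i \in arrows_at b l) = (i < size b)%N && (rank b i == l%:Z).
Proof. by rewrite mem_filter mem_iota andbC. Qed.

Lemma mem_level_arrows phi b l i :
  (i \in level_arrows phi b l) = (i < size b)%N && (rank b i == l%:Z).
Proof. by rewrite (perm_mem (perm_level_arrows phi b l)) mem_arrows_at. Qed.

Lemma filter_sweep_levels phi b l K :
  [seq i <- flatten [seq level_arrows phi b r | r <- iota 0 K] | rank b i == l%:Z]
  = if (l < K)%N then level_arrows phi b l else [::].
Proof.
elim: K => [|K IH] //.
rewrite -addn1 iotaD map_cat flatten_cat filter_cat IH /= cats0 add0n.
have all_K x : x \in level_arrows phi b K -> rank b x = K%:Z.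
  by rewrite mem_level_arrows => /andP[_ /eqP].
have [->|lK] := eqVneq l K.
  rewrite ltnn addn1 ltnSn /= (eq_in_filter (a2 := xpredT)) ?filter_predT //.
  by move=> x /all_K ->; rewrite eqxx.
rewrite (eq_in_filter (a2 := pred0)) ?filter_pred0 ?cats0.
  by have -> : (l < K + 1)%N = (l < K)%N by lia.
by move=> x /all_K ->; rewrite eqz_nat eq_sym (negbTE lK).
Qed.

Lemma filter_sweep_order phi b l :
  [seq i <- sweep_order phi b | rank b i == l%:Z] = level_arrows phi b l.
Proof.
rewrite filter_sweep_levels; case: ifP => // lM; apply/esym/eqP.
rewrite -size_eq0 (perm_size (perm_level_arrows _ _ _)) size_eq0.
apply/eqP/eqP; rewrite -[_ == _]negbK -has_filter; apply/hasPn => i.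
rewrite mem_iota => /andP[_ ib]; apply/eqP => e.
by have := leq_max_rank b i ib; rewrite e; lia.
Qed.

(** The disjunct [rank b i == 0] leaves level 0 unordered, since [phi] decides there; every other
    level runs from right to left. *)
Definition sweep_before (b : seq int) : rel nat := fun i j =>
  (rank b i < rank b j) || (rank b i == rank b j) && ((rank b i == 0) || (j < i)%N).

Lemma pairwise_level_arrows phi b l : pairwise (sweep_before b) (level_arrows phi b l).
Proof.
have Hl : all (fun i => rank b i == l%:Z) (level_arrows phi b l).
  by apply/allP => i; rewrite mem_level_arrows => /andP[].
case: l Hl => [|l] Hl.
  apply: (sub_in_pairwise (P := fun i => rank b i == 0) (r := fun _ _ => true)) => //.
    by move=> i j; rewrite -!topredE /= /sweep_before => /eqP -> /eqP ->; rewrite eqxx orbT.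
  by elim: (level_arrows _ _ _) => //= x s ->; rewrite andbT; apply/allP.
apply: (sub_in_pairwise (P := fun i => rank b i == l.+1%:Z) (r := fun i j => (j < i)%N)) => //.
  by move=> i j; rewrite -!topredE /= /sweep_before => /eqP -> /eqP -> ->; rewrite eqxx !orbT.
rewrite -sorted_pairwise; last by move=> x y z /=; lia.
by rewrite rev_sorted; apply: sorted_filter; [exact: ltn_trans | exact: iota_ltn_sorted].
Qed.

Lemma pairwise_sweep_order phi b : pairwise (sweep_before b) (sweep_order phi b).
Proof.
rewrite /sweep_order; move: (max_rank b).+1 0%N => K; elim: K => [|K IH] m //=.
rewrite pairwise_cat pairwise_level_arrows IH !andbT; apply/allrelP => i j.
rewrite mem_level_arrows => /andP[_ /eqP ri] /flattenP[s /mapP[l]].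
rewrite mem_iota => /andP[ml _] ->; rewrite mem_level_arrows => /andP[_ /eqP rj].
by rewrite /sweep_before ri rj ltz_nat ml.
Qed.

Lemma perm_sweep_order phi b : nonneg_ranks b ->
  perm_eq (sweep_order phi b) (iota 0 (size b)).
Proof.
move=> b0; apply/seq.permP => q.
(* The first [K] levels list exactly the arrows of rank below [K]; nonnegativity starts the
   induction at [K = 0]. *)
have : forall K, count q (flatten [seq level_arrows phi b r | r <- iota 0 K]) =
   count (fun i => (rank b i < K%:Z) && q i) (iota 0 (size b)).
  elim=> [|K IH].
    rewrite /= (eq_in_count (a2 := pred0)) ?count_pred0 // => i; rewrite mem_iota /= add0n => ib.
    by have := b0 i (ltnW ib); case: ltP.
  rewrite -addn1 iotaD map_cat flatten_cat count_cat IH /= cats0 add0n.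
  rewrite (seq.permP (perm_level_arrows phi b K)) count_filter -count_predUI.
  rewrite [X in (_ + X)%N](eq_count (a2 := pred0)) ?count_pred0 ?addn0.
    by apply: eq_count => i /=; case: (q i); rewrite ?andbF ?andbT //=; lia.
  by move=> i /=; case: (q i); rewrite ?andbF ?andbT //=; lia.
move=> /(_ (max_rank b).+1) ->; apply: eq_in_count => i; rewrite mem_iota => /andP[_ ib].
have := leq_max_rank b i ib; have := b0 i (ltnW ib); case: ltP => //=; lia.
Qed.

(** * Balance and exit times of the swept ranks *)

Definition sweep_rank (phi : forall k : nat, 'S_k) (b : seq int) (k : nat) : int :=
  rank b (nth 0%N (sweep_order phi b) k).

Lemma size_sweep_order phi b : nonneg_ranks b -> size (sweep_order phi b) = size b.
Proof. by move=> b0; rewrite (perm_size (perm_sweep_order phi b b0)) size_iota. Qed.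

Lemma mem_sweep_order phi b i : nonneg_ranks b ->
  (i \in sweep_order phi b) = (i < size b)%N.
Proof. by move=> b0; rewrite (perm_mem (perm_sweep_order phi b b0)) mem_iota. Qed.

Lemma nth_sweep_order_lt phi b k : nonneg_ranks b -> (k < size b)%N ->
  (nth 0%N (sweep_order phi b) k < size b)%N.
Proof. by move=> b0 kb; rewrite -(mem_sweep_order phi) // mem_nth // size_sweep_order. Qed.

Lemma size_Osweep phi b : nonneg_ranks b -> size (Osweep phi b) = size b.
Proof. by move=> b0; rewrite OsweepE size_map size_sweep_order. Qed.

Lemma perm_Osweep phi b : nonneg_ranks b -> perm_eq (Osweep phi b) b.
Proof.
move=> b0; rewrite OsweepE; apply: perm_trans (perm_map _ (perm_sweep_order phi b b0)) _.
by rewrite map_nth_iota0 // take_size.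
Qed.

Lemma sweep_rank_end phi b k : nonneg_ranks b -> (k < size b)%N ->
  sweep_rank phi b k + nth 0 (Osweep phi b) k =
  rank b (nth 0%N (sweep_order phi b) k).+1.
Proof.
move=> b0 kb; rewrite OsweepE (nth_map 0%N) ?size_sweep_order //.
by rewrite rankS ?nth_sweep_order_lt.
Qed.

Lemma sum_sweep_order phi b (F : nat -> int) : nonneg_ranks b ->
  \sum_(k < size b) F (nth 0%N (sweep_order phi b) k) = \sum_(i < size b) F i.
Proof.
move=> b0; rewrite -[RHS](big_mkord xpredT F).
rewrite -(big_mkord xpredT (fun k => F (nth 0%N (sweep_order phi b) k))).
rewrite -{1}(size_sweep_order phi b b0).
rewrite -(big_nth 0%N xpredT F) (perm_big _ (perm_sweep_order phi b b0)) /=.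
by rewrite /index_iota subn0.
Qed.

(** The sweep permutes the arrows, so this is the telescoping sum of [f] along the path. Indicators
    of [x < l] give balance; truncations at [l] give nonnegativity of the image. *)
Lemma sweep_rank_balance phi b (f : int -> int) : nonneg_ranks b ->
  f 0 + \sum_(k < size b) f (sweep_rank phi b k) =
  f (init_rank b) +
    \sum_(k < size b) f (sweep_rank phi b k + nth 0 (Osweep phi b) k).
Proof.
move=> b0; rewrite (sum_sweep_order phi b (fun i => f (rank b i))) //.
under [X in _ = _ + X]eq_bigr => k _ do rewrite sweep_rank_end //.
rewrite (sum_sweep_order phi b (fun i => f (rank b i.+1))) //.
have := telescope_sumr (fun i => f (rank b i)) (leq0n (size b)).
rewrite big_mkord sumrB rank_size rank0 => h.
by rewrite -[f 0](subrK (f (init_rank b))) -h; ring.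
Qed.

Lemma balanced_sweep_rank phi b : nonneg_ranks b ->
  balanced (size b) (init_rank b) (nth 0 (Osweep phi b)) (sweep_rank phi b).
Proof.
move=> b0; split=> [i ib|i ib|l].
- by apply/b0/ltnW/nth_sweep_order_lt.
- by rewrite sweep_rank_end //; exact/b0/nth_sweep_order_lt.
have := sweep_rank_balance phi b (fun x => ((x < l)%R : nat)%:Z) b0.
rewrite /below; under eq_bigr do rewrite -natz.
under [X in _ = _ + X -> _]eq_bigr do rewrite -natz.
by rewrite -!natr_sum !natz -!PoszD => -[h]; rewrite addnC h addnC.
Qed.

Lemma sweep_before_nth phi b i j : nonneg_ranks b -> (i < j < size b)%N ->
  sweep_before b (nth 0%N (sweep_order phi b) i) (nth 0%N (sweep_order phi b) j).
Proof.
move=> b0 /andP[ij jb]; have /(pairwiseP 0%N) h := pairwise_sweep_order phi b.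
by apply: h; rewrite // inE size_sweep_order //; apply: ltn_trans jb.
Qed.

Lemma nondecreasing_sweep_rank phi b : nonneg_ranks b ->
  nondecreasing_upto (size b) (sweep_rank phi b).
Proof.
move=> b0 i j /andP[]; rewrite leq_eqVlt => /predU1P[-> //|ij] jb.
have := sweep_before_nth phi b i j b0; rewrite ij jb => /(_ isT).
by rewrite /sweep_before /sweep_rank => /orP[/ltW //|/andP[/eqP -> _]].
Qed.

(** A positive level is swept from right to left, so its first swept arrow is the rightmost one. *)
Lemma first_at_last_exit phi b k i : nonneg_ranks b -> (k < size b)%N ->
  first_at (sweep_rank phi b) k -> 0 < sweep_rank phi b k ->
  (i < size b)%N -> rank b i = sweep_rank phi b k ->
  (i <= nth 0%N (sweep_order phi b) k)%N.
Proof.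
move=> b0 kb fk rk ib ri; pose s := sweep_order phi b.
have is_ : i \in s by rewrite mem_sweep_order.
have ej : nth 0%N s (index i s) = i by rewrite nth_index.
have jb : (index i s < size b)%N by rewrite -(size_sweep_order phi b b0) index_mem.
have [jk|kj|<-] := ltngtP (index i s) k; last by rewrite -/s ej.
  by have := fk _ jk; rewrite /sweep_rank -/s ej -[ltRHS]ri ltxx.
have := sweep_before_nth phi b k (index i s) b0; rewrite kj jb => /(_ isT).
rewrite /sweep_before -/s ej -/(sweep_rank phi b k) ri ltxx eqxx /=.
by rewrite (gt_eqF rk) /= => /ltnW.
Qed.

Lemma exits_increase_sweep_rank phi b : nonneg_ranks b ->
  exits_increase (size b) (nth 0 (Osweep phi b)) (sweep_rank phi b)
    (nth 0%N (sweep_order phi b)).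
Proof.
move=> b0 k k' kb k'b fk fk' rk rk' e.
rewrite sweep_rank_end // in e.
(* The time just after arrow [k] is a visit to the level of [k'], hence at most its last exit. It is
   not the final time, since the path ends at 0 and this level is positive. *)
apply: (first_at_last_exit phi b k') => //; rewrite ltn_neqAle.
rewrite nth_sweep_order_lt // andbT; apply/eqP => es.
by move: rk'; rewrite e es rank_size ltxx.
Qed.

Lemma init_rank_Osweep phi b : nonneg_ranks b ->
  init_rank (Osweep phi b) = init_rank b.
Proof. by move=> b0; rewrite /init_rank (perm_big _ (perm_Osweep phi b b0)). Qed.

(* Apply the balance identity to x |-> min(x, l), where l is the starting rank
   of the k-th swept arrow: only the k arrows before it contribute to an
   increase of the right-hand side, each at most by its step. *)
Lemma nonneg_ranks_Osweep phi b : nonneg_ranks b -> nonneg_ranks (Osweep phi b).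
Proof.
move=> b0 k; rewrite leq_eqVlt => /predU1P[->|]; first by rewrite rank_size.
rewrite size_Osweep // => kb; rewrite /rank init_rank_Osweep //.
pose l := sweep_rank phi b k; pose w := nth 0 (Osweep phi b).
have l0 : 0 <= l by apply/b0/ltnW/nth_sweep_order_lt.
have bal := sweep_rank_balance phi b (fun x => Num.min x l) b0.
have -> : \sum_(x <- take k (Osweep phi b)) x = \sum_(i < k) w i.
  rewrite (big_nth 0) size_takel ?size_Osweep 1?ltnW // big_mkord.
  by apply: eq_bigr => i _; rewrite nth_take.
have : \sum_(i < size b) (Num.min (sweep_rank phi b i + w i) l -
          Num.min (sweep_rank phi b i) l) <= \sum_(i < k) w i.
  rewrite (big_ord_widen (size b) w (ltnW kb)) [leRHS]big_mkcond /=.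
  apply: ler_sum => i _; have ib := ltn_ord i.
  case: ltnP => ik.
    have := nondecreasing_sweep_rank phi b b0 i k; rewrite (ltnW ik) kb => /(_ isT).
    by rewrite -/l; lia.
  have := nondecreasing_sweep_rank phi b b0 k i; rewrite ik ib => /(_ isT).
  by rewrite -/l; lia.
(* By the balance identity the left-hand sum is minus the minimum of the initial rank and [l]. *)
rewrite sumrB; move: bal; rewrite (min_l l0) add0r => ->.
have : Num.min (init_rank b) l <= init_rank b by rewrite ge_min lexx.
rewrite -/w; set A := \sum_(i < size b) _; set C := \sum_(i < k) _; lia.
Qed.

(** * Recovering the path *)

(** The initial rank [c] is a parameter so that induction can pass to the tail of [b]. *)
Definition steps_from (c : int) (b : seq int) (l : int) : seq int :=
  [seq nth 0 b i | i <- iota 0 (size b) & c + \sum_(x <- take i b) x == l].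

Lemma steps_from_cons c x s l :
  steps_from c (x :: s) l =
  (if c == l then [:: x] else [::]) ++ steps_from (c + x) s l.
Proof.
rewrite /steps_from /= big_nil addr0 (iotaDl 1 0) filter_map.
have -> : [seq i <- iota 0 (size s) |
    preim (addn 1) (fun i => c + \sum_(y <- take i (x :: s)) y == l) i] =
  [seq i <- iota 0 (size s) | c + x + \sum_(y <- take i s) y == l].
  by apply: eq_filter => i /=; rewrite big_cons addrA.
by case: (c == l); rewrite /= -map_comp.
Qed.

Lemma steps_from_inj c b b' : (forall l, steps_from c b l = steps_from c b' l) -> b = b'.
Proof.
elim: b b' c => [|x s IH] [|x' s'] c //.
- by move=> /(_ c); rewrite steps_from_cons eqxx.
- by move=> /(_ c); rewrite steps_from_cons eqxx.
move=> h; have := h c; rewrite !steps_from_cons eqxx => -[ex _]; congr cons => //.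
apply: (IH _ (c + x)) => l; have := h l; rewrite !steps_from_cons -ex.
by case: (c == l) => // -[].
Qed.

Lemma steps_from_nat b (l : nat) :
  steps_from (init_rank b) b l%:Z = [seq nth 0 b i | i <- arrows_at b l].
Proof. by []. Qed.

Lemma steps_from_neg b (l : int) : nonneg_ranks b -> l < 0 ->
  steps_from (init_rank b) b l = [::].
Proof.
move=> b0 l0; rewrite /steps_from (eq_in_filter (a2 := pred0)) ?filter_pred0 //.
move=> i; rewrite mem_iota => /andP[_ ib]; have := b0 i (ltnW ib).
by rewrite /rank /= => ri; apply/eqP => e; rewrite e leNgt l0 in ri.
Qed.

Lemma map_nth_perm_inj (T : Type) (x0 : T) n (p : 'S_n) (s s' : seq T) :
  size s = n -> size s' = n ->
  [seq nth x0 s (p j) | j <- enum 'I_n] = [seq nth x0 s' (p j) | j <- enum 'I_n] ->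
  s = s'.
Proof.
move=> sn sn' h; apply: (@eq_from_nth _ x0); rewrite ?sn' // sn => i ni.
pose j := p^-1%g (Ordinal ni); have nj := ltn_ord j.
have nthE t : nth x0 [seq nth x0 t (p k) | k <- enum 'I_n] j = nth x0 t i.
  by rewrite (nth_map j _ (fun k => nth x0 t (p k))) ?size_enum_ord // nth_ord_enum permKV.
by rewrite -nthE h nthE.
Qed.

(** Reversal is undone at positive levels. At level 0 both lists have the same length, hence the
    same permutation from [phi] was applied and can be inverted. *)
Lemma level_steps_inj phi b b' l :
  [seq nth 0 b i | i <- level_arrows phi b l] =
  [seq nth 0 b' i | i <- level_arrows phi b' l] ->
  [seq nth 0 b i | i <- arrows_at b l] = [seq nth 0 b' i | i <- arrows_at b' l].
Proof.
case: l => [|l]; last by rewrite !map_rev => /(congr1 rev); rewrite !revK.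
rewrite /= /zero_arrows; move: (arrows_at b 0) (arrows_at b' 0) => s s' h.
have es : size s' = size s.
  by have := congr1 size h; rewrite 4!size_map !size_enum_ord.
move: h; rewrite es => h.
apply: (map_nth_perm_inj _ 0 (size s) (phi (size s))); rewrite ?size_map //.
have nthE (c : seq int) t : size t = size s ->
    [seq nth 0 [seq nth 0 c i | i <- t] (phi (size s) j) | j <- enum 'I_(size s)] =
    [seq nth 0 c i | i <- [seq nth 0%N t (phi (size s) j) | j <- enum 'I_(size s)]].
  by move=> ts; rewrite -map_comp; apply: eq_map => j /=; rewrite (nth_map 0%N) // ts.
by rewrite !nthE.
Qed.

Lemma Osweep_inj phi b b' : nonneg_ranks b -> nonneg_ranks b' ->
  Osweep phi b = Osweep phi b' -> b = b'.
Proof.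
move=> b0 b0' eO.
have es : size b = size b' by rewrite -(size_Osweep phi b) // eO size_Osweep.
have ea : init_rank b = init_rank b'.
  by rewrite -(init_rank_Osweep phi b) // eO init_rank_Osweep.
have a0 : 0 <= init_rank b by rewrite -rank0 b0.
have sumw : \sum_(i < size b) nth 0 (Osweep phi b) i = - init_rank b.
  rewrite -(init_rank_Osweep phi b) // /init_rank opprK [RHS](big_nth 0) big_mkord.
  by rewrite size_Osweep.
have er i : (i < size b)%N -> sweep_rank phi b i = sweep_rank phi b' i.
  have br := balanced_sweep_rank phi b b0.
  have bs := balanced_sweep_rank phi b' b0'; rewrite -eO -es -ea in bs.
  have mr := nondecreasing_sweep_rank phi b b0.
  have ms := nondecreasing_sweep_rank phi b' b0'; rewrite -es in ms.
  have xr := exits_increase_sweep_rank phi b b0.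
  have xs := exits_increase_sweep_rank phi b' b0'; rewrite -eO -es in xs.
  apply: (balanced_unique _ _ _ _ _ _ _ (size b) a0 sumw br bs mr ms xr _ xs _) => k kb.
    exact: nth_sweep_order_lt.
  by rewrite es nth_sweep_order_lt -?es.
(* With equal ranks attached to equal letters, filtering by rank yields the same swept steps at
   every level. *)
have ez : [seq (rank b i, nth 0 b i) | i <- sweep_order phi b] =
          [seq (rank b' i, nth 0 b' i) | i <- sweep_order phi b'].
  have h c : nonneg_ranks c -> [seq (rank c i, nth 0 c i) | i <- sweep_order phi c] =
      zip (mkseq (sweep_rank phi c) (size c)) (Osweep phi c).
    move=> c0; rewrite -zip_map -OsweepE; congr zip.
    rewrite -[in LHS](mkseq_nth 0%N (sweep_order phi c)) size_sweep_order //.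
    by rewrite /mkseq -map_comp.
  rewrite !h // eO -es; congr zip; apply/eq_in_map => i; rewrite mem_iota => /andP[_ ib].
  exact: er.
apply: (steps_from_inj (init_rank b)) => l.
have [l0|l0] := ltP l 0; first by rewrite steps_from_neg // ea steps_from_neg.
rewrite {2}ea -(gez0_abs l0) !steps_from_nat; apply: (level_steps_inj phi).
rewrite -!filter_sweep_order.
have h c : [seq nth 0 c i | i <- sweep_order phi c & rank c i == (`|l|%N)%:Z] =
   [seq p.2 | p <- [seq (rank c i, nth 0 c i) | i <- sweep_order phi c] & p.1 == (`|l|%N)%:Z].
  by rewrite filter_map -map_comp.
by rewrite !h ez.
Qed.

(** * Bijectivity from finiteness *)

Lemma finite_inj_set_bij (T : eqType) (A : set T) (f : T -> T) (e : seq T) :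
  (forall x, A x -> x \in e) -> set_fun A A f -> set_inj A f -> set_bij A A f.
Proof.
move=> Ae fA fi; split=> //.
(* [P] lists [A] without repetition; its image under [f] lies in [P] and has the same length, so it
   exhausts [P]. *)
pose P := [seq x <- undup e | `[< A x >]].
have memP x : (x \in P) = `[< A x >].
  rewrite mem_filter mem_undup; case: (boolP `[< A x >]) => //= /asboolP /Ae ->.
  by [].
have uP : uniq P by rewrite filter_uniq // undup_uniq.
have ufP : uniq [seq f x | x <- P].
  rewrite map_inj_in_uniq // => x y; rewrite !memP => /asboolP Ax /asboolP Ay.
  by apply: fi; rewrite inE.
have sub : {subset [seq f x | x <- P] <= P}.
  move=> y /mapP[x]; rewrite memP => /asboolP Ax ->.
  by rewrite memP; apply/asboolP; exact: fA.
have [_ eqP_] := uniq_min_size ufP sub (eq_leq (esym (size_map f P))).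
move=> y Ay; have : y \in P by rewrite memP; apply/asboolP.
by rewrite -eqP_ => /mapP[x]; rewrite memP => /asboolP Ax ->; exists x.
Qed.

Theorem theorem4 (B : {mset int}) (phi : forall k : nat, 'S_k)
    (hB : \sum_(x <- B) x < 0) :
  set_bij (incomplete_dyck B) (incomplete_dyck B) (Osweep phi).
Proof.
(* Every word of type [B] is a permutation of a fixed enumeration of [B]. *)
apply: (@finite_inj_set_bij _ _ _ (permutations (B : seq int))).
- move=> b [bB _ _]; rewrite mem_permutations -bB perm_sym.
  exact: perm_eq_seq_mset.
- move=> b [bB a0 b0]; split.
  + by rewrite -bB; apply/eq_seq_msetP; exact: perm_Osweep.
  + by rewrite init_rank_Osweep.
  + exact: nonneg_ranks_Osweep.
- move=> b b'; rewrite !inE => -[_ _ b0] [_ _ b0']; exact: Osweep_inj.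
Qed.
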